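(* Let $E$ be a Dedekind complete Riesz space with a weak order unit $e$, and let $(f_n)_{n\in\mathbb{N}_0}$ be an order bounded sequence in the positive cone $E_+$. Then $\frac{1}{n}\sum_{k=0}^{n-1}f_k\to 0$ in order as $n\to\infty$ if and only if there exists a density zero sequence of band projections $(P_n)_{n\in\mathbb{N}_0}$ on $E$ such that $(I-P_n)f_n\to 0$ in order as $n\to\infty$.
   Context: A sequence $(P_n)_{n\in\mathbb{N}_0}$ of band projections on a Riesz space $E$ is said to be of density zero if $\frac{1}{n}\sum_{k=0}^{n-1}P_k\to 0$ in order as $n\to\infty$ (order convergence in the space of order bounded operators on $E$). $I$ denotes the identity operator on $E$. *)

(* Defs.v *)
From mathcomp Require Import all_boot all_order all_algebra.
From mathcomp Require Import reals.
Set Implicit Arguments. Unset Strict Implicit. Unset Printing Implicit Defensive.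
Import Order.TTheory GRing.Theory Num.Theory.
Local Open Scope ring_scope.

Section Riesz.
Variables (R : realType) (E : lmodType R) (le : E -> E -> Prop).

Definition is_lub (A : E -> Prop) (s : E) : Prop :=
  (forall x, A x -> le x s) /\ (forall u, (forall x, A x -> le x u) -> le s u).
Definition is_glb (A : E -> Prop) (s : E) : Prop :=
  (forall x, A x -> le s x) /\ (forall u, (forall x, A x -> le u x) -> le u s).

Definition riesz_space : Prop :=
  [/\ (forall x, le x x),
      (forall x y, le x y -> le y x -> x = y),
      (forall x y z, le x y -> le y z -> le x z),
      (forall x y z, le x y -> le (x + z) (y + z)) &
      (forall (a : R) x y, 0 <= a -> le x y -> le (a *: x) (a *: y))] /\
  (forall x y, exists s, is_lub (fun z => z = x \/ z = y) s).

Definition dedekind_complete : Prop :=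
  forall A : E -> Prop, (exists x, A x) -> (exists u, forall x, A x -> le x u) ->
  exists s, is_lub A s.

Definition is_abs (x a : E) : Prop := is_lub (fun z => z = x \/ z = - x) a.

Definition disjoint (x y : E) : Prop :=
  exists a b, [/\ is_abs x a, is_abs y b & is_glb (fun z => z = a \/ z = b) 0].

Definition band (B : E -> Prop) : Prop :=
  [/\ B 0,
      (forall x y, B x -> B y -> B (x + y)),
      (forall (a : R) x, B x -> B (a *: x)),
      (forall x y a b, is_abs x a -> is_abs y b -> le a b -> B y -> B x) &
      (forall (A : E -> Prop) s, (forall x, A x -> B x) -> is_lub A s -> B s)].

Definition disj_compl (B : E -> Prop) : E -> Prop :=
  fun x => forall y, B y -> disjoint x y.

Definition weak_order_unit (e : E) : Prop :=
  le 0 e /\ e <> 0 /\ (forall B, band B -> B e -> forall x, B x).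

Definition band_projection (P : E -> E) : Prop :=
  exists B, band B /\ forall x, B (P x) /\ disj_compl B (x - P x).

Definition oconv (x : nat -> E) (l : E) : Prop :=
  exists p : nat -> E,
    [/\ (forall n, le (p n.+1) (p n)),
        is_glb (fun z => exists n, z = p n) 0 &
        (forall n, exists a, is_abs (x n - l) a /\ le a (p n))].

Definition linear_op (T : E -> E) : Prop :=
  forall (a : R) x y, T (a *: x + y) = a *: T x + T y.
Definition order_bounded (T : E -> E) : Prop :=
  linear_op T /\ forall a b, exists c d, forall x, le a x -> le x b -> le c (T x) /\ le (T x) d.
Definition leop (S T : E -> E) : Prop := forall x, le 0 x -> le (S x) (T x).

(* order convergence to 0 in L_b(E): there are order bounded Q_n decreasing,
   with infimum 0 in L_b(E), and |S_n| <= Q_n, written as -Q_n <= S_n <= Q_n *)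
Definition oconv_op0 (S : nat -> E -> E) : Prop :=
  exists Q : nat -> E -> E,
    [/\ (forall n, order_bounded (Q n)),
        (forall n, leop (Q n.+1) (Q n)),
        (forall n, leop (fun _ => 0) (Q n)),
        (forall T, order_bounded T -> (forall n, leop T (Q n)) -> leop T (fun _ => 0)) &
        (forall n, leop (fun x => - Q n x) (S n) /\ leop (S n) (Q n))].

Definition density_zero (P : nat -> E -> E) : Prop :=
  oconv_op0 (fun n x => (n%:R)^-1 *: \sum_(k < n) P k x).

End Riesz.

(* Main.v *)
(* If the means of f are dominated by p_n decreasing to 0, put P_n on the band
   where f_n exceeds c_n, a square root of p_n: then (I - P_n) f_n <= c_n. Since
   c is decreasing, the mean of P_0, ..., P_(n-1) applied to c_n is at most p_n,
   so that off the band where p_n > t^2 e this mean is at most t I; that band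
   shrinks to 0 as n grows.
   Conversely f_n <= P_n b + (I - P_n) f_n for an upper bound b, and both terms
   have means tending to 0. *)
Require Import Defs.
From mathcomp Require Import all_boot all_order all_algebra.
From mathcomp Require Import reals.
From mathcomp Require Import boolp classical_sets lra.
Set Implicit Arguments. Unset Strict Implicit. Unset Printing Implicit Defensive.
Import Order.TTheory GRing.Theory Num.Theory.
Local Open Scope ring_scope.

(** The estimate for the means of the [P k] is available only at the single vector [c n], whereas
    [density_zero] concerns operators. It passes from [c n] to other vectors because band
    projections commute: on each piece cut out by [P 0], ..., [P (n-1)] their sum is an integer
    multiple of the identity, so an upper bound tested on one vector holds on the whole band
    generated by it. For that band to be all of [E], [c n] must be a weak unit, which is why [p] is
    enlarged by [e / (n+1)]. A square root is used because [c] has to tend to 0 while the ratio of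
    [p n] to [c n] tends to 0 as well. Order convergence of operators asks for a dominating sequence
    with infimum 0 among order bounded operators. Dedekind completeness lets the relevant suprema
    and infima be computed on the positive cone, so that both directions reduce to inequalities
    between vectors. *)

Section RieszSpace.
Context (R : realType) (E : lmodType R) (le : E -> E -> Prop).
Hypothesis hR : riesz_space le.
Local Notation "x <<= y" := (le x y) (at level 70, y at next level).

(** * Order rules in an ordered vector space *)

Lemma lev_refl x : x <<= x.
Proof. by case: hR => [[]]. Qed.

Lemma lev_anti x y : x <<= y -> y <<= x -> x = y.
Proof. by case: hR => [[_ + _ _ _] _]; apply. Qed.

Lemma lev_trans y x z : x <<= y -> y <<= z -> x <<= z.
Proof. by case: hR => [[_ _ + _ _] _]; apply. Qed.

Lemma levD x y z w : x <<= y -> z <<= w -> x + z <<= y + w.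
Proof.
case: hR => [[_ _ _ hadd _] _] xy zw; apply: (@lev_trans (y + z)).
  exact: hadd.
by rewrite ![y + _]addrC; apply: hadd.
Qed.

Lemma levZ (a : R) x y : 0 <= a -> x <<= y -> a *: x <<= a *: y.
Proof. by case: hR => [[_ _ _ _ +] _]; apply. Qed.

Lemma levBl z x y : x + z <<= y <-> x <<= y - z.
Proof.
split=> h.
  by rewrite -(addrK z x); apply: levD h (lev_refl _).
by rewrite -(subrK z y); apply: levD h (lev_refl _).
Qed.

Lemma levBr z x y : x - z <<= y <-> x <<= y + z.
Proof. by rewrite levBl opprK. Qed.

Lemma subv_ge0 x y : 0 <<= y - x <-> x <<= y.
Proof. by rewrite -levBl add0r. Qed.

Lemma levN x y : x <<= y -> - y <<= - x.
Proof. by move=> xy; rewrite -subv_ge0 opprK addrC subv_ge0. Qed.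

Lemma lev_oppl x y : - x <<= y <-> - y <<= x.
Proof. by split=> /levN; rewrite opprK. Qed.

Lemma lev_oppr x y : x <<= - y <-> y <<= - x.
Proof. by split=> /levN; rewrite opprK. Qed.

Lemma addv_ge0 x y : 0 <<= x -> 0 <<= y -> 0 <<= x + y.
Proof. by move=> x0 y0; rewrite -[0]addr0; apply: levD. Qed.

Lemma lev_addl x y : 0 <<= y -> x <<= x + y.
Proof. by move=> y0; rewrite -{1}[x]addr0; apply: levD; [exact: lev_refl|]. Qed.

Lemma lev_addr x y : 0 <<= y -> x <<= y + x.
Proof. by rewrite addrC; apply: lev_addl. Qed.

Lemma scalev_ge0 (a : R) x : 0 <= a -> 0 <<= x -> 0 <<= a *: x.
Proof. by move=> a0 x0; rewrite -(scaler0 _ a); apply: levZ. Qed.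

Lemma levZr (a b : R) x : a <= b -> 0 <<= x -> a *: x <<= b *: x.
Proof.
by move=> ab x0; rewrite -subv_ge0 -scalerBl; apply: scalev_ge0; rewrite ?subr_ge0.
Qed.

Lemma levZ_inv (a : R) x y : 0 < a -> x <<= a^-1 *: y <-> a *: x <<= y.
Proof.
move=> a0; have a00 : a != 0 by rewrite gt_eqF.
split=> h; first by rewrite -[y](scalerKV a00); apply: levZ => //; exact: ltW.
by rewrite -[x](scalerK a00); apply: levZ => //; rewrite invr_ge0 ltW.
Qed.

Lemma levZ_invl (a : R) x y : 0 < a -> a^-1 *: x <<= y <-> x <<= a *: y.
Proof. by move=> a0; rewrite -levZ_inv ?invr_gt0 // invrK. Qed.

Lemma levZK (a : R) x y : 0 < a -> a *: x <<= a *: y -> x <<= y.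
Proof.
by move=> a0; rewrite -levZ_inv // scalerA mulVf ?gt_eqF // scale1r.
Qed.

Lemma lev_sum n (F G : 'I_n -> E) :
  (forall i, F i <<= G i) -> \sum_i F i <<= \sum_i G i.
Proof.
move=> FG; elim/big_ind2 : _ => [|x1 x2 y1 y2|i _]; [|exact: levD|exact: FG].
exact: lev_refl.
Qed.

Lemma sumv_ge0 n (F : 'I_n -> E) : (forall i, 0 <<= F i) -> 0 <<= \sum_i F i.
Proof.
by move=> F0; elim/big_ind : _ => //; [exact: lev_refl | exact: addv_ge0].
Qed.

(** * Positive parts, Riesz decomposition, absolute values *)

Definition pos x : E := xget 0 (is_lub le (fun z => z = x \/ z = 0)).

Lemma pos_lub x : is_lub le (fun z => z = x \/ z = 0) (pos x).
Proof. by apply: xgetPex; case: hR => _; apply. Qed.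

Lemma pos_ge0 x : 0 <<= pos x.
Proof. by case: (pos_lub x) => + _; apply; right. Qed.

Lemma pos_ge x : x <<= pos x.
Proof. by case: (pos_lub x) => + _; apply; left. Qed.

Lemma pos_le x u : x <<= u -> 0 <<= u -> pos x <<= u.
Proof. by move=> xu u0; case: (pos_lub x) => _; apply => z [] ->. Qed.

Lemma posB_ge0 x : 0 <<= pos x - x.
Proof. by rewrite subv_ge0; exact: pos_ge. Qed.

Lemma le_pos x y : x <<= y -> pos x <<= pos y.
Proof.
by move=> xy; apply: pos_le (pos_ge0 _); apply: lev_trans xy (pos_ge _).
Qed.

(** Disjointness of positive and negative part, phrased through common lower bounds: subtracting [z]
    from [pos x] leaves an upper bound of [x] and 0. *)
Lemma pos_disj x z : z <<= pos x -> z <<= pos x - x -> z <<= 0.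
Proof.
move=> z1 z2; have : pos x <<= pos x - z.
  apply: pos_le; last by rewrite subv_ge0.
  by move: z2; rewrite -levBl addrC levBl.
by rewrite -levBl addrC levBl subrr.
Qed.

Lemma riesz_decomposition z x y : 0 <<= z -> 0 <<= x -> 0 <<= y -> z <<= x + y ->
  exists z1 z2, [/\ z = z1 + z2, 0 <<= z1, z1 <<= x, 0 <<= z2 & z2 <<= y].
Proof.
(* [z - pos (z - x)] is the meet of [z] and [x]. *)
move=> z0 x0 y0 zxy; exists (z - pos (z - x)), (pos (z - x)); split.
- by rewrite subrK.
- rewrite subv_ge0; apply: pos_le => //.
  by rewrite levBr; apply: lev_addl.
- by rewrite levBr addrC -levBr; exact: pos_ge.
- exact: pos_ge0.
- by apply: pos_le => //; rewrite levBr addrC.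
Qed.

Lemma riesz_refinement a b x y : 0 <<= a -> 0 <<= b -> 0 <<= x -> 0 <<= y ->
  a + b = x + y ->
  exists a1 a2 b1 b2, [/\ a = a1 + a2, b = b1 + b2, x = a1 + b1, y = a2 + b2 &
    [/\ 0 <<= a1, 0 <<= a2, 0 <<= b1 & 0 <<= b2]].
Proof.
move=> a0 b0 x0 y0 abxy.
have [|a1 [a2 [aE a10 a1x a20 a2y]]] := riesz_decomposition a0 x0 y0.
  by rewrite -abxy; apply: lev_addl.
exists a1, a2, (x - a1), (y - a2); split=> //.
- apply: (addrI a); rewrite abxy aE addrACA; congr (_ + _).
    by rewrite addrC subrK.
  by rewrite addrC subrK.
- by rewrite addrC subrK.
- by rewrite addrC subrK.
- by split=> //; rewrite subv_ge0.
Qed.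

Lemma is_abs_exists x : exists a, is_abs le x a.
Proof. by case: hR => _; apply. Qed.

Lemma is_absW x a : is_abs le x a -> [/\ x <<= a, - x <<= a & 0 <<= a].
Proof.
move=> [ub _]; have h1 : x <<= a by apply: ub; left.
have h2 : - x <<= a by apply: ub; right.
split=> //; have := levD h1 h2; rewrite subrr -mulr2n -scaler_nat => h.
by apply: (@levZK 2) => //; rewrite scaler0.
Qed.

Lemma is_abs_le x a u : is_abs le x a -> x <<= u -> - x <<= u -> a <<= u.
Proof. by move=> [_ lub] xu nxu; apply: lub => z [] ->. Qed.

Lemma is_abs_pos x : 0 <<= x -> is_abs le x x.
Proof.
move=> x0; split=> [z [] ->|u]; [exact: lev_refl| |by apply; left].
apply: (@lev_trans 0) => //; rewrite -oppr0; exact: levN.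
Qed.

Hypothesis hD : dedekind_complete le.

(** The multiples [n.+1%:R *: x] are bounded by [y]; since adding [x] to one gives another, their
    supremum [s] satisfies [s <<= s - x]. *)
Lemma archimedean x y : (forall t : R, 0 < t -> x <<= t *: y) -> x <<= 0.
Proof.
move=> xy; pose A z := exists n, z = n.+1%:R *: x.
have [||s [ub least]] := hD (A := A).
- by exists (1%:R *: x), 0%N.
- exists y => _ [n ->]; rewrite -levZ_inv ?ltr0n//.
  by apply: xy; rewrite invr_gt0 ltr0n.
- have : s <<= s - x.
    apply: least => _ [n ->]; rewrite -levBl; apply: ub.
    by exists n.+1; rewrite [in RHS]mulrSr scalerDl scale1r.
  by rewrite -levBl addrC levBl subrr.
Qed.

Lemma glb_exists (A : E -> Prop) :
  (exists x, A x) -> (exists u, forall x, A x -> u <<= x) ->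
  exists s, is_glb le A s.
Proof.
move=> [x Ax] [u uA].
have [||s [ub least]] := hD (A := fun z => A (- z)).
- by exists (- x); rewrite opprK.
- by exists (- u) => z /uA; rewrite lev_oppr.
exists (- s); split=> [z Az|v vA].
  by rewrite lev_oppl; apply: ub; rewrite opprK.
by rewrite lev_oppr; apply: least => z /vA; rewrite lev_oppr.
Qed.

(** * Linear operators built from their values on the positive cone *)

Lemma linop0 (T : E -> E) : linear_op T -> T 0 = 0.
Proof.
move=> lT; have := lT 1 0 0; rewrite !scale1r addr0 => /eqP.
by rewrite -subr_eq subrr eq_sym => /eqP.
Qed.

Lemma linopD (T : E -> E) x y : linear_op T -> T (x + y) = T x + T y.
Proof. by move=> lT; have := lT 1 x y; rewrite !scale1r. Qed.

Lemma linopZ (T : E -> E) a x : linear_op T -> T (a *: x) = a *: T x.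
Proof. by move=> lT; rewrite -[a *: x]addr0 lT (linop0 lT) addr0. Qed.

Lemma linopB (T : E -> E) x y : linear_op T -> T (x - y) = T x - T y.
Proof. by move=> lT; rewrite linopD // -scaleN1r linopZ // scaleN1r. Qed.

Lemma linop_sum (T : E -> E) n (F : 'I_n -> E) :
  linear_op T -> T (\sum_i F i) = \sum_i T (F i).
Proof.
move=> lT; apply: (big_morph T) => [x y|]; [exact: linopD | exact: linop0].
Qed.

(** Kantorovich extension: every vector is a difference of positive ones, and additivity makes the
    difference of the values independent of the representation ([TB]). *)
Lemma cone_extension (T0 : E -> E) :
  (forall x y, 0 <<= x -> 0 <<= y -> T0 (x + y) = T0 x + T0 y) ->
  (forall (a : R) x, 0 < a -> 0 <<= x -> T0 (a *: x) = a *: T0 x) ->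
  exists T, linear_op T /\ forall x, 0 <<= x -> T x = T0 x.
Proof.
move=> T0D T0Z; pose T x := T0 (pos x) - T0 (pos x - x).
have T00 : T0 0 = 0.
  have := T0D 0 0 (lev_refl _) (lev_refl _); rewrite addr0 => /eqP.
  by rewrite -subr_eq subrr eq_sym => /eqP.
have T0Z' (a : R) x : 0 <= a -> 0 <<= x -> T0 (a *: x) = a *: T0 x.
  rewrite le_eqVlt => /predU1P[<- _|]; last exact: T0Z.
  by rewrite !scale0r T00.
have TB u v : 0 <<= u -> 0 <<= v -> T (u - v) = T0 u - T0 v.
  move=> u0 v0; set x := u - v.
  have shift p : p + v = u + (p - x) by rewrite /x opprB [u + _]addrC -addrA subrK.
  have px := pos_ge0 x; have nx := posB_ge0 x.
  have := congr1 T0 (shift (pos x)); rewrite (T0D _ v) // (T0D u) // => {}shift.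
  by apply/eqP; rewrite /T subr_eq addrAC -shift addrK.
exists T; split=> [a x y|x x0]; last first.
  by rewrite -[x in LHS]subr0 TB ?T00 ?subr0 //; exact: lev_refl.
have decomp z : z = pos z - (pos z - z) by rewrite opprB addrC subrK.
have px := pos_ge0 x; have nx := posB_ge0 x.
have py := pos_ge0 y; have ny := posB_ge0 y.
rewrite {1}[x]decomp {1}[y]decomp /(T x) /(T y).
move: (pos x) (pos x - x) (pos y) (pos y - y) px nx py ny => {decomp} p q r s.
move=> p0 q0 r0 s0; have [a0|a0] := leP 0 a.
  rewrite scalerBr addrACA -opprD TB; try by apply: addv_ge0 => //; apply: scalev_ge0.
  rewrite !T0D; try by [|apply: scalev_ge0].
  by rewrite !T0Z'// opprD addrACA scalerBr.
have na0 : 0 <= - a by lra.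
rewrite -[a *: _]opprK -scaleNr -scalerN opprB scalerBr addrACA -opprD.
rewrite TB; try by apply: addv_ge0 => //; apply: scalev_ge0.
rewrite !T0D; try by [|apply: scalev_ge0].
rewrite !T0Z'// opprD addrACA -scalerBr; congr (_ + _).
by rewrite scaleNr -scalerN opprB.
Qed.

(** [F x] collects candidate values at [x]. The third and fourth hypotheses make the supremum
    superadditive and subadditive; one scaling inclusion suffices, as applying it to [a^-1] gives
    the reverse inequality. This one scheme yields principal projections, suprema of monotone
    sequences of operators and the Riesz-Kantorovich formula. *)
Lemma sup_op (F : E -> E -> Prop) :
  (forall x, 0 <<= x -> exists z, F x z) ->
  (forall x, 0 <<= x -> exists u, forall z, F x z -> z <<= u) ->
  (forall x y z w, 0 <<= x -> 0 <<= y -> F x z -> F y w ->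
    exists2 v, F (x + y) v & z + w <<= v) ->
  (forall x y v, 0 <<= x -> 0 <<= y -> F (x + y) v ->
    exists z w, [/\ F x z, F y w & v <<= z + w]) ->
  (forall (a : R) x z, 0 < a -> F x z -> F (a *: x) (a *: z)) ->
  exists T, linear_op T /\ forall x, 0 <<= x -> is_lub le (F x) (T x).
Proof.
move=> Fne Fbd FD FD' FZ; pose T0 x := xget 0 (is_lub le (F x)).
have T0P x : 0 <<= x -> is_lub le (F x) (T0 x).
  by move=> x0; apply: xgetPex; apply: hD; [exact: Fne | exact: Fbd].
have T0_ub x z : 0 <<= x -> F x z -> z <<= T0 x by move=> /T0P[+ _]; apply.
have T0_least x u : 0 <<= x -> (forall z, F x z -> z <<= u) -> T0 x <<= u.
  by move=> /T0P[_]; apply.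
have [x y x0 y0|a x a0 x0|T [lT TE]] := @cone_extension T0.
- have xy0 := addv_ge0 x0 y0; apply: lev_anti.
    apply: (T0_least) => // v /(FD' _ _ _ x0 y0)[z [w [Fz Fw vzw]]].
    by apply: lev_trans vzw _; apply: levD; exact: T0_ub.
  rewrite addrC levBl; apply: (T0_least) => // w Fw; rewrite -levBl addrC levBl.
  apply: (T0_least) => // z Fz; rewrite -levBl.
  by have [v Fv zwv] := FD _ _ _ _ x0 y0 Fz Fw; apply: lev_trans zwv (T0_ub _ _ _ _).
- have ax0 := scalev_ge0 (ltW a0) x0; apply: lev_anti.
    apply: (T0_least) => // z Fz.
    have ai : 0 < a^-1 by rewrite invr_gt0.
    rewrite -[a]invrK levZ_inv //; apply: (T0_ub) => //.
    by have := FZ _ _ _ ai Fz; rewrite scalerA mulVf ?gt_eqF// scale1r.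
  rewrite -levZ_inv //; apply: (T0_least) => // z Fz.
  by rewrite levZ_inv //; apply: (T0_ub) => //; apply: FZ.
by exists T; split=> // x x0; rewrite TE //; exact: T0P.
Qed.

(** * Order projections *)

(** An algebraic form of band projections, in which complements and products are immediate;
    [oproj_band_projection] returns to the form with a band. *)
Definition oproj (P : E -> E) : Prop :=
  [/\ linear_op P, (forall x, P (P x) = P x) &
      (forall x, 0 <<= x -> 0 <<= P x /\ P x <<= x)].

Lemma oproj_ge0 P x : oproj P -> 0 <<= x -> 0 <<= P x.
Proof. by move=> [_ _ P01] /P01[]. Qed.

Lemma oproj_lex P x : oproj P -> 0 <<= x -> P x <<= x.
Proof. by move=> [_ _ P01] /P01[]. Qed.

Lemma oproj_mono P x y : oproj P -> x <<= y -> P x <<= P y.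
Proof.
move=> hP xy; have [lP _ _] := hP.
by rewrite -subv_ge0 -(linopB _ _ lP); apply: oproj_ge0 => //; rewrite subv_ge0.
Qed.

Lemma oproj_compl P : oproj P -> oproj (fun x => x - P x).
Proof.
move=> [lP PP P01]; split=> [a x y|x|x x0].
- by rewrite lP scalerBr opprD addrACA.
- by rewrite linopB // PP subrr subr0.
- have [Px0 Pxx] := P01 _ x0; split; first by rewrite subv_ge0.
  by rewrite levBr; exact: lev_addl.
Qed.

(** The complement of [P] is positive and kills [x], hence kills everything between 0 and [x]. *)
Lemma oproj_fix_le P x z : oproj P -> P x = x -> 0 <<= z -> z <<= x -> P z = z.
Proof.
move=> hP Px z0 zx; have hN := oproj_compl hP.
have := oproj_mono hN zx; rewrite /= Px subrr => h.
have := oproj_ge0 hN z0 => h'; apply/eqP; rewrite eq_sym -subr_eq0; apply/eqP.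
exact: lev_anti.
Qed.

(** Since [Q z <<= z] on the cone, [Q] maps the range of [P] and the range of its complement into
    themselves, by [oproj_fix_le]. *)
Lemma oproj_comm P Q x : oproj P -> oproj Q -> P (Q x) = Q (P x).
Proof.
move=> hP hQ; have [lP PP _] := hP; have [lQ _ _] := hQ.
suff {x} comm x : 0 <<= x -> P (Q x) = Q (P x).
  have -> : x = pos x - (pos x - x) by rewrite opprB addrC subrK.
  rewrite (linopB _ _ lQ) (linopB _ _ lP) (linopB (T := P) _ (pos x - x)) //.
  rewrite (linopB (T := Q) _ (P (pos x - x))) // !comm //; last exact: pos_ge0.
  exact: posB_ge0.
move=> x0; have hN := oproj_compl hP.
have Px0 := oproj_ge0 hP x0; have Nx0 := oproj_ge0 hN x0.
have PQP : P (Q (P x)) = Q (P x).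
  by apply: (oproj_fix_le hP (PP x)); [exact: oproj_ge0 | exact: oproj_lex].
have [_ NN _] := hN.
have : Q (x - P x) - P (Q (x - P x)) = Q (x - P x).
  by apply: (oproj_fix_le hN (NN x)); [exact: oproj_ge0 | exact: oproj_lex].
move=> /eqP; rewrite -subr_eq0 addrAC subrr add0r oppr_eq0 => /eqP.
rewrite (linopB _ _ lQ) (linopB _ _ lP) PQP => /eqP.
by rewrite subr_eq0 => /eqP.
Qed.

Lemma oproj_comp P Q : oproj P -> oproj Q -> oproj (fun x => P (Q x)).
Proof.
move=> hP hQ; have [lP PP _] := hP; have [lQ QQ _] := hQ; split.
- by move=> a x y; rewrite lQ lP.
- by move=> x; rewrite -(oproj_comm (Q x)) // QQ PP.
- move=> x x0; have Qx0 := oproj_ge0 hQ x0; split; first exact: oproj_ge0.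
  by apply: (@lev_trans (Q x)); exact: oproj_lex.
Qed.

Lemma oproj_abs P x a : oproj P -> is_abs le x a -> P x = x -> P a = a.
Proof.
move=> hP xa Px; have [x1 x2 a0] := is_absW xa; have [lP _ _] := hP.
apply: lev_anti; first exact: oproj_lex.
apply: (is_abs_le xa); first by rewrite -Px; apply: oproj_mono.
by rewrite -Px -sub0r -(linop0 lP) -linopB // sub0r; apply: oproj_mono.
Qed.

Lemma oproj_band P : oproj P -> band le (fun x => P x = x).
Proof.
move=> hP; have hN := oproj_compl hP; have [lP PP _] := hP; split.
- exact: linop0.
- by move=> x y Px Py; rewrite linopD // Px Py.
- by move=> a x Px; rewrite linopZ // Px.
- move=> x y a b xa yb ab Py; have Pb := oproj_abs hP yb Py.
  have [x1 x2 a0] := is_absW xa.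
  have Pa : P a = a by apply: oproj_fix_le ab.
  (* [x] itself has no sign; the vector [a + x] lies between 0 and twice the fixed vector [a], so it
     is fixed, and [a] can be subtracted. *)
  have ax0 : 0 <<= a + x by rewrite -[x]opprK subv_ge0.
  have axa : a + x <<= 2%:R *: a by rewrite scaler_nat mulr2n; apply: levD => //; exact: lev_refl.
  have : P (a + x) = a + x.
    by apply: (oproj_fix_le hP _ ax0 axa); rewrite linopZ // Pa.
  by rewrite linopD // Pa => /addrI.
- move=> A s AP [ub least]; apply: lev_anti.
    have [[x Ax]|A0] := pselect (exists x, A x).
      have := oproj_mono hN (ub _ Ax); rewrite /= AP // subrr.
      by rewrite subv_ge0.
    (* With [A] empty every vector is an upper bound, so [s] lies below any vector whatsoever. *)
    have : s <<= s - (P s - s) by apply: least => x Ax; case: A0; exists x.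
    by rewrite -levBl addrC subrK.
  by apply: least => x Ax; rewrite -(AP _ Ax); apply: oproj_mono => //; exact: ub.
Qed.

Lemma oproj_band_projection P : oproj P -> band_projection le P.
Proof.
move=> hP; have hN := oproj_compl hP; exists (fun x => P x = x).
split; first exact: oproj_band.
have [lP PP _] := hP; move=> x; split=> // y Py.
have [a xa] := is_abs_exists (x - P x); have [b yb] := is_abs_exists y.
exists a, b; split=> //; have Pb := oproj_abs hP yb Py.
have Na : a - P a = a by apply: (oproj_abs hN xa); have [_ NN _] := hN; rewrite NN.
have [_ _ a0] := is_absW xa; have [_ _ b0] := is_absW yb.
split=> [z [] ->//|u uab]; rewrite -(subrK (P u) u) -[X in _ <<= X]addr0.
apply: levD.
  rewrite -(subrr b) -{2}Pb; apply: (oproj_mono hN); apply: uab; by right.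
rewrite -(subrr a) -{2}Na opprB addrC subrK.
apply: (oproj_mono hP); apply: uab; by left.
Qed.

Lemma oproj_full (e : E) P : weak_order_unit le e -> oproj P -> P e = e ->
  forall x, P x = x.
Proof. by move=> [_ [_ he]] hP; apply: he (oproj_band hP). Qed.

(** * Projections onto principal bands *)

(** This is the classical formula for [P x] as the supremum over [n] of the meets of [x] with [n u],
    written without meets. *)
Definition principal_proj (u : E) (P : E -> E) : Prop :=
  oproj P /\ forall x, 0 <<= x ->
    is_lub le (fun y => [/\ 0 <<= y, y <<= x & exists2 s : R, 0 <= s & y <<= s *: u]) (P x).

Lemma principal_proj_exists u : 0 <<= u -> exists P, principal_proj u P.
Proof.
move=> u0.
have [x x0|x x0|x y z w x0 y0 [z0 zx [s s0 zu]] [w0 wy [t t0 wu]]| |a x z a0|P [lP PP]] := @sup_op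
  (fun x y => [/\ 0 <<= y, y <<= x & exists2 s : R, 0 <= s & y <<= s *: u]).
- by exists 0; split=> //; [exact: lev_refl | exists 0 => //; rewrite scale0r; exact: lev_refl].
- by exists x => z [].
- exists (z + w); last exact: lev_refl.
  split; [exact: addv_ge0 | exact: levD | exists (s + t); first exact: addr_ge0].
  by rewrite scalerDl; apply: levD.
- move=> x y v x0 y0 [v0 vxy [s s0 vu]].
  have [z [w [vE z0 zx w0 wy]]] := riesz_decomposition v0 x0 y0 vxy.
  exists z, w; split; [split=> //|split=> //|rewrite vE; exact: lev_refl].
    by exists s => //; apply: lev_trans vu; rewrite vE; exact: lev_addl.
  by exists s => //; apply: lev_trans vu; rewrite vE; exact: lev_addr.
- move=> [z0 zx [s s0 zu]]; split; [apply: scalev_ge0 => //; exact: ltW| |].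
    by apply: levZ => //; exact: ltW.
  exists (a * s); first by apply: mulr_ge0 => //; exact: ltW.
  by rewrite -scalerA; apply: levZ => //; exact: ltW.
have P01 x : 0 <<= x -> 0 <<= P x /\ P x <<= x.
  move=> x0; have [ub least] := PP x x0; split; last by apply: least => y [].
  apply: ub; split=> //; first exact: lev_refl.
  by exists 0 => //; rewrite scale0r; exact: lev_refl.
have PPpos x : 0 <<= x -> P (P x) = P x.
  move=> x0; have [Px0 Pxx] := P01 x x0; apply: lev_anti.
    by have [] := P01 _ Px0.
  have [ub least] := PP x x0; have [ub' _] := PP _ Px0.
  by apply: least => y [y0 yx yu]; apply: ub'; split=> //; exact: ub.
exists P; split=> //; split=> // x.
have -> : x = pos x - (pos x - x) by rewrite opprB addrC subrK.
rewrite (linopB _ _ lP) (linopB _ _ lP) !PPpos //; [exact: posB_ge0 | exact: pos_ge0].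
Qed.

Lemma principal_proj_id u P : 0 <<= u -> principal_proj u P -> P u = u.
Proof.
move=> u0 [hP PP]; apply: lev_anti; first exact: oproj_lex.
have [ub _] := PP u u0; apply: ub; split=> //; first exact: lev_refl.
by exists 1 => //; rewrite scale1r; exact: lev_refl.
Qed.

Lemma principal_proj_disj u P x : 0 <<= u -> principal_proj u P -> 0 <<= x ->
  (forall z, z <<= u -> z <<= x -> z <<= 0) -> P x = 0.
Proof.
move=> u0 [hP PP] x0 dis; apply: lev_anti; last exact: oproj_ge0.
have [_ least] := PP x x0; apply: least => y [y0 yx [s s0 yu]].
(* The factor [s + 1] is at least both [s] and 1, so dividing [y] by it gives a vector below [u] and
   below [x] at once. *)
have s1 : 0 < s + 1 by lra.
have : (s + 1)^-1 *: y <<= 0.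
  apply: dis; rewrite levZ_invl //.
    by apply: lev_trans yu _; apply: levZr => //; lra.
  apply: lev_trans yx _; rewrite -{1}[x]scale1r; apply: levZr => //; lra.
by rewrite levZ_invl // scaler0.
Qed.

(** [P] fixes the positive part of [v] and kills the negative part, which is disjoint from it. *)
Lemma principal_proj_pos v P : principal_proj (pos v) P -> P v = pos v.
Proof.
move=> hP; have [[lP _ _] _] := hP.
have {1}-> : v = pos v - (pos v - v) by rewrite opprB addrC subrK.
rewrite linopB // (principal_proj_id (pos_ge0 v) hP).
rewrite (principal_proj_disj (pos_ge0 v) hP) ?subr0 //; first exact: posB_ge0.
exact: pos_disj.
Qed.

Lemma le_principal_proj u v P Q x : u <<= v -> principal_proj u P ->
  principal_proj v Q -> 0 <<= x -> P x <<= Q x.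
Proof.
move=> uv [_ PP] [_ QQ] x0; have [_ least] := PP x x0; have [ub _] := QQ x x0.
apply: least => y [y0 yx [s s0 yu]]; apply: ub; split=> //; exists s => //.
by apply: lev_trans yu _; apply: levZ.
Qed.

(** Turns the definition of a weak unit by bands into the form by disjointness: the projection onto
    the band of [e] is the identity, yet kills [x]. *)
Lemma unit_disjoint e x : weak_order_unit le e -> 0 <<= x ->
  (forall z, z <<= e -> z <<= x -> z <<= 0) -> x = 0.
Proof.
move=> he x0 dis; have [e0 _] := he.
have [P hP] := principal_proj_exists e0.
rewrite -(principal_proj_disj e0 hP x0 dis) (oproj_full he) //; first by case: hP.
exact: principal_proj_id.
Qed.

(* Splitting along [P n] and its complement removes one projection from the
   sum and shifts [s] by one or zero; at the bottom a negative [s] forces [c = 0]. *)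
Lemma sum_oproj_le n (P : nat -> E -> E) c y (s : R) :
  (forall k, oproj (P k)) -> 0 <<= c -> 0 <<= y ->
  (forall Q, oproj Q -> Q c = 0 -> Q y = 0) ->
  \sum_(k < n) P k c <<= s *: c -> \sum_(k < n) P k y <<= s *: y.
Proof.
move=> hP; elim: n c y s => [|n IH] c y s c0 y0 cy.
  rewrite !big_ord0 => sc; have [s0|s0] := leP 0 s; first exact: scalev_ge0.
  have cE : c = 0.
    apply: lev_anti => //; apply: (@levZK (- s)); first by lra.
    by rewrite scaler0 scaleNr -[0]oppr0; apply: levN.
  have hid : oproj id by split=> // x x0; split=> //; exact: lev_refl.
  by rewrite (cy id hid cE) scaler0; exact: lev_refl.
rewrite !big_ord_recr /= => sc.
have hPn := hP n; have hN := oproj_compl hPn.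
have [lP PP _] := hPn; have [lN NN _] := hN.
(* Projections commute, so [Q] moves inside the sum and the induction hypothesis applies to [Q c]
   and [Q y]; [Q y] still lies in the band generated by [Q c]. *)
have IHQ Q s' : oproj Q -> Q (\sum_(k < n) P k c) <<= s' *: Q c ->
    Q (\sum_(k < n) P k y) <<= s' *: Q y.
  move=> hQ; have [lQ _ _] := hQ.
  have QE z : Q (\sum_(k < n) P k z) = \sum_(k < n) P k (Q z).
    rewrite (linop_sum _ lQ); by apply: eq_bigr => k _; rewrite (oproj_comm _ hQ (hP k)).
  rewrite !QE; apply: IH; try by apply: oproj_ge0.
  move=> Q' hQ'; apply: (cy (fun x => Q' (Q x))); exact: oproj_comp.
have h1 : P n (\sum_(k < n) P k y) <<= (s - 1) *: P n y.
  apply: IHQ => //; have := oproj_mono hPn sc.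
  by rewrite linopD // PP linopZ // levBl scalerBl scale1r.
have h2 := IHQ _ s hN; have /h2 : \sum_(k < n) P k c - P n (\sum_(k < n) P k c) <<= s *: (c - P n c).
  have := oproj_mono hN sc; rewrite (linopD _ _ lN) (linopZ _ _ lN) /=.
  by rewrite PP subrr addr0.
move: (\sum_(k < n) P k y) h1 => S h1 h3.
have := levD h1 h3; rewrite [P n S + _]addrC subrK => h.
rewrite levBl; apply: lev_trans h _; rewrite scalerBr scalerBl scale1r.
by rewrite [_ - P n y + _]addrC addrA subrK; exact: lev_refl.
Qed.

(** * Sequences decreasing to zero *)

Definition decreasing_to0 (p : nat -> E) : Prop :=
  (forall n, p n.+1 <<= p n) /\ is_glb le (fun z => exists n, z = p n) 0.

Lemma decreasing_to0_le p m n : decreasing_to0 p -> (m <= n)%N -> p n <<= p m.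
Proof.
move=> [pS _] /subnKC <-; elim: (n - m)%N => [|k IH]; first by rewrite addn0; exact: lev_refl.
by rewrite addnS; apply: lev_trans IH.
Qed.

Lemma decreasing_to0_ge0 p n : decreasing_to0 p -> 0 <<= p n.
Proof. by move=> [_ [lb _]]; apply: lb; exists n. Qed.

Lemma decreasing_to0_inf p z : decreasing_to0 p -> (forall n, z <<= p n) -> z <<= 0.
Proof. by move=> [_ [_ gt]] zp; apply: gt => _ [n ->]. Qed.

Lemma decreasing_to0D p q : decreasing_to0 p -> decreasing_to0 q ->
  decreasing_to0 (fun n => p n + q n).
Proof.
move=> hp hq; split.
  by move=> n; apply: levD; [case: hp | case: hq].
split=> [_ [n ->]|u upq].
  by apply: addv_ge0; exact: decreasing_to0_ge0.
apply: (decreasing_to0_inf hq) => m; rewrite -[q m]add0r -levBr.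
apply: (decreasing_to0_inf hp) => n; rewrite levBr.
(* Taking the larger index decouples the two sequences, so each infimum can be taken separately. *)
have upq' := upq _ (ex_intro _ (maxn n m) erefl); apply: lev_trans upq' _.
by apply: levD; apply: decreasing_to0_le => //; rewrite ?leq_maxl ?leq_maxr.
Qed.

Lemma decreasing_to0_harmonic x : 0 <<= x -> decreasing_to0 (fun n => n.+1%:R^-1 *: x).
Proof.
move=> x0; split=> [n|].
  by apply: levZr => //; rewrite lef_pV2 ?posrE ?ltr0n// ler_nat.
split=> [_ [n ->]|u ux]; first by apply: scalev_ge0; rewrite ?invr_ge0.
apply: (@archimedean u x) => t t0.
have nt : t^-1 < (Num.bound t^-1)%:R by apply: archi_boundP; rewrite invr_ge0 ltW.
apply: (@lev_trans ((Num.bound t^-1).+1%:R^-1 *: x)); first by apply: ux; eexists.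
apply: levZr => //; rewrite -[X in _ <= X]invrK lef_pV2 ?posrE ?invr_gt0 ?ltr0n //.
by apply: (le_trans (ltW nt)); rewrite ler_nat.
Qed.

(** An exchange of infima over [j] and [n]. A single [y j] need not tend to 0:
    [t *: e + t^-1 *: p n] decreases only to [t *: e]. *)
Lemma decreasing_to0_inf_family (J : Type) (y : J -> nat -> E) :
  inhabited J -> (forall j n, 0 <<= y j n) -> (forall j n, y j n.+1 <<= y j n) ->
  (forall z, (forall j n, z <<= y j n) -> z <<= 0) ->
  exists p, (forall n, is_glb le (fun z => exists j, z = y j n) (p n)) /\ decreasing_to0 p.
Proof.
move=> [j0] y0 yS yinf.
have /choice [p pP] n : exists s, is_glb le (fun z => exists j, z = y j n) s.
  by apply: glb_exists; [exists (y j0 n), j0 | exists 0 => _ [j ->]].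
have py j n : p n <<= y j n by have [lb _] := pP n; apply: lb; exists j.
exists p; split=> //; split=> [n|].
  by have [_ gt] := pP n; apply: gt => _ [j ->]; apply: lev_trans (yS j n).
split=> [_ [n ->]|u up].
  by have [_ gt] := pP n; apply: gt => _ [j ->].
by apply: yinf => j n; apply: (@lev_trans (p n)) => //; apply: up; exists n.
Qed.

Lemma oconv0_intro x p : decreasing_to0 p ->
  (forall n, 0 <<= x n) -> (forall n, x n <<= p n) -> oconv le x 0.
Proof.
move=> [pS p0] x0 xp; exists p; split=> // n; exists (x n); split=> //.
by rewrite subr0; exact: is_abs_pos.
Qed.

Lemma oconv0_dominated x : oconv le x 0 ->
  exists2 p, decreasing_to0 p & forall n, x n <<= p n.
Proof.
move=> [p [pS p0 xp]]; exists p => // n; have [a [xa ap]] := xp n.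
by have [+ _ _] := is_absW xa; rewrite subr0 => xa'; apply: lev_trans ap.
Qed.

(** * Band projections as the statement gives them *)

Lemma disjoint_ge0 x y z a b : Defs.disjoint le x y -> is_abs le x a -> is_abs le y b ->
  z <<= a -> z <<= b -> z <<= 0.
Proof.
move=> [a' [b' [xa' yb' [_ gt]]]] xa yb za zb; apply: gt => _ [] ->.
  apply: lev_trans za _; have [h1 h2 _] := is_absW xa'; exact: is_abs_le xa h1 h2.
apply: lev_trans zb _; have [h1 h2 _] := is_absW yb'; exact: is_abs_le yb h1 h2.
Qed.

(** Derived from the pointwise splitting of [x] and [y]. The positive part [w] of [P x - P y] lies
    in [B], and is dominated by the sum of the moduli of two vectors disjoint from [B]; Riesz
    decomposition cuts it into two pieces, each of which vanishes. *)
Lemma band_projection_mono P x y : band_projection le P -> x <<= y -> P x <<= P y.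
Proof.
move=> [B [[B0 BD BZ Bsolid _] hP]] xy.
have [[Bx dx] [By dy]] := (hP x, hP y).
set d1 := x - P x in dx; set d2 := y - P y in dy.
have [a1 d1a] := is_abs_exists d1; have [a2 d2a] := is_abs_exists d2.
have [d1a1 nd1a1 a10] := is_absW d1a; have [d2a2 nd2a2 a20] := is_absW d2a.
pose w := pos (P x - P y); have w0 : 0 <<= w := pos_ge0 _.
have Bv : B (P x - P y) by rewrite -scaleN1r; apply: BD => //; exact: BZ.
have Bw : B w.
  have [a va] := is_abs_exists (P x - P y); have [h1 h2 a0] := is_absW va.
  by apply: (Bsolid _ _ _ _ (is_abs_pos w0) va) => //; apply: pos_le.
have wle : w <<= a1 + a2.
  apply: pos_le; last exact: addv_ge0.
  have -> : P x - P y = (x - y) + (d2 - d1).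
    rewrite /d1 /d2 opprB [y - P y + _]addrC addrACA addKr.
    by rewrite [x + _]addrC subrK.
  rewrite -[a1 + a2]add0r [a1 + a2]addrC; apply: levD; last exact: levD.
  by rewrite levBr add0r.
have [w1 [w2 [wE w10 w1a w20 w2a]]] := riesz_decomposition w0 a10 a20 wle.
have small d z : disj_compl le B d -> 0 <<= z -> z <<= w -> forall a, is_abs le d a -> z <<= a -> z <<= 0.
  move=> dd z0 zw a da za; have Bz : B z by apply: (Bsolid _ _ _ _ (is_abs_pos z0) (is_abs_pos w0)).
  exact: (disjoint_ge0 (dd _ Bz) da (is_abs_pos z0) za (lev_refl _)).
have w1w : w1 <<= w by rewrite wE; exact: lev_addl.
have w2w : w2 <<= w by rewrite wE; exact: lev_addr.
have h1 := small _ _ dx w10 w1w _ d1a w1a.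
have h2 := small _ _ dy w20 w2w _ d2a w2a.
have := levD h1 h2; rewrite -wE addr0 => {}h1.
have := lev_trans (pos_ge (P x - P y)) h1; by rewrite levBr add0r.
Qed.

(** * Order convergence of operators *)

Lemma linop_mono (T : E -> E) x y : linear_op T -> (forall z, 0 <<= z -> 0 <<= T z) ->
  x <<= y -> T x <<= T y.
Proof.
by move=> lT T0 xy; rewrite -subv_ge0 -(linopB _ _ lT); apply: T0; rewrite subv_ge0.
Qed.

Lemma positive_order_bounded (T : E -> E) : linear_op T ->
  (forall z, 0 <<= z -> 0 <<= T z) -> order_bounded le T.
Proof.
move=> lT T0; split=> // a b; exists (T a), (T b) => x ax xb.
by split; apply: linop_mono.
Qed.

(** The infimum 0 of [Q n] is taken among operators, and evaluation at [b] must preserve it. The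
    supremum [T] of the [Q 0 - Q n] on the cone is linear, so [Q 0 - T] is an order bounded operator
    below every [Q n], hence below 0. A lower bound [u] of all [Q n b] gives [T b <<= Q 0 b - u],
    which forces [u <<= 0]. *)
Lemma oconv_op0_apply S b : oconv_op0 le S -> 0 <<= b ->
  exists2 p, decreasing_to0 p & forall n, S n b <<= p n.
Proof.
move=> [Q [Qbd QS Q0 Qinf SQ]] b0; exists (fun n => Q n b); last first.
  by move=> n; have [_] := SQ n; apply.
have lQ n : linear_op (Q n) by have [] := Qbd n.
have Qmono m n x : 0 <<= x -> (m <= n)%N -> Q n x <<= Q m x.
  move=> x0 /subnKC <-; elim: (n - m)%N => [|k IH]; first by rewrite addn0; exact: lev_refl.
  by rewrite addnS; apply: lev_trans IH; exact: QS.
split=> [n|]; first exact: QS.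
split=> [_ [n ->]|u uQ]; first exact: Q0.
have [x x0|x x0|x y z w x0 y0 [m ->] [n ->]|x y v x0 y0 [n ->]|a x z a0 [n ->]|T [lT TP]] :=
  @sup_op (fun x z => exists n, z = Q 0%N x - Q n x).
- by exists 0, 0%N; rewrite subrr.
- by exists (Q 0%N x) => _ [n ->]; rewrite levBr; apply: lev_addl; exact: Q0.
- exists (Q 0%N (x + y) - Q (maxn m n) (x + y)); first by eexists.
  rewrite !(linopD _ _ (lQ _)) opprD addrACA; apply: levD; first exact: lev_refl.
  by rewrite -!opprD; apply: levN; apply: levD; apply: Qmono; rewrite ?leq_maxl ?leq_maxr.
- exists (Q 0%N x - Q n x), (Q 0%N y - Q n y); split; try by eexists.
  by rewrite !(linopD _ _ (lQ _)) opprD addrACA; exact: lev_refl.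
- by exists n; rewrite !(linopZ _ _ (lQ _)) scalerBr.
have lQT : linear_op (fun x => Q 0%N x - T x).
  by move=> a x y; rewrite lQ lT scalerBr opprD addrACA.
have QT0 x : 0 <<= x -> Q 0%N x <<= T x.
  move=> x0; rewrite -[T x]addr0 addrC -levBr.
  apply: (Qinf (fun x => Q 0%N x - T x)) => //.
    apply: positive_order_bounded => // z z0; rewrite subv_ge0.
    have [_ least] := TP z z0; apply: least => _ [n ->].
    by rewrite levBr; apply: lev_addl; exact: Q0.
  move=> n z z0; have [ub _] := TP z z0; rewrite levBr addrC -levBr.
  by apply: ub; exists n.
have Tb : T b <<= Q 0%N b - u.
  have [_ least] := TP b b0; apply: least => _ [n ->].
  by apply: levD; [exact: lev_refl | apply: levN; apply: uQ; exists n].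
have := lev_trans (QT0 _ b0) Tb.
by rewrite -levBl addrC levBl subrr.
Qed.

(* [op_decomp D N x z] holds when [z] is a finite sum of [D M (x_M)] with
   [M >= N], where the positive [x_M] add up to [x]; the Riesz-Kantorovich
   formula for the supremum of [D M], [M >= N], takes the supremum of such [z]. *)
Inductive op_decomp (D : nat -> E -> E) (N : nat) : E -> E -> Prop :=
| op_decomp1 M x : (N <= M)%N -> 0 <<= x -> op_decomp D N x (D M x)
| op_decompD x y z w : op_decomp D N x z -> op_decomp D N y w ->
    op_decomp D N (x + y) (z + w).

Lemma op_decomp_ge0 D N x z : op_decomp D N x z -> 0 <<= x.
Proof. by elim=> // *; apply: addv_ge0. Qed.

Lemma op_decomp_le D N (B : E -> E) :
  (forall x y, B (x + y) = B x + B y) ->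
  (forall M x, (N <= M)%N -> 0 <<= x -> D M x <<= B x) ->
  forall x z, op_decomp D N x z -> z <<= B x.
Proof.
move=> BD DB x z; elim=> [M {}x NM x0|{}x y {}z w _ zx _ wy]; first exact: DB.
by rewrite BD; apply: levD.
Qed.

(** Induction on the decomposition: leaves split by linearity, and at a sum [riesz_refinement]
    distributes [x] and [y] over both summands. *)
Lemma op_decomp_split D N x y v : (forall M, linear_op (D M)) ->
  0 <<= x -> 0 <<= y -> op_decomp D N (x + y) v ->
  exists z w, [/\ op_decomp D N x z, op_decomp D N y w & v = z + w].
Proof.
move=> lD x0 y0; move sE: (x + y) => s h.
elim: {s v} h x y x0 y0 sE => [M s NM s0|s1 s2 v1 v2 h1 IH1 h2 IH2] x y x0 y0.
  by move=> <-; exists (D M x), (D M y); split; rewrite ?(linopD _ _ (lD _)) //; exact: op_decomp1.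
move=> /esym /(riesz_refinement (op_decomp_ge0 h1) (op_decomp_ge0 h2) x0 y0).
move=> [a1 [a2 [b1 [b2 [aE bE -> -> [a10 a20 b10 b20]]]]]].
have [z1 [w1 [hz1 hw1 ->]]] := IH1 _ _ a10 a20 (esym aE).
have [z2 [w2 [hz2 hw2 ->]]] := IH2 _ _ b10 b20 (esym bE).
exists (z1 + z2), (w1 + w2); split; [exact: op_decompD..|].
by rewrite addrACA.
Qed.

(** The dominating [Q N] is the supremum of the tail [D M], [M >= N]. An additive bound for the tail
    bounds each of its decompositions and hence [Q N], so it is enough that the bounds [B j n] have
    joint infimum 0 at each vector; no single [j] has to work. *)
Lemma oconv_op0_intro (J : Type) (D : nat -> E -> E) (B : J -> nat -> E -> E) :
  (forall n, linear_op (D n)) ->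
  (forall n x, 0 <<= x -> 0 <<= D n x /\ D n x <<= x) ->
  (forall j n x y, B j n (x + y) = B j n x + B j n y) ->
  (forall j m n x, (m <= n)%N -> 0 <<= x -> D n x <<= B j m x) ->
  (forall x z, 0 <<= x -> (forall j n, z <<= B j n x) -> z <<= 0) ->
  oconv_op0 le D.
Proof.
move=> lD D01 BD DB Binf.
have /choice [Q QP] N : exists Q, linear_op Q /\
    forall x, 0 <<= x -> is_lub le (op_decomp D N x) (Q x).
  apply: sup_op => [x x0|x x0|x y z w x0 y0 hz hw|x y v x0 y0|a x z a0].
  - by exists (D N x); apply: op_decomp1.
  - exists x; apply: (op_decomp_le (B := id)) => // M y _ y0.
    by have [] := D01 M y y0.
  - by exists (z + w); [exact: op_decompD | exact: lev_refl].
  - move=> /(op_decomp_split lD x0 y0)[z [w [hz hw ->]]].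
    by exists z, w; split=> //; exact: lev_refl.
  - elim=> [M {}x NM x0|{}x y {}z w _ zx _ wy].
      by rewrite -(linopZ _ _ (lD _)); apply: op_decomp1 => //; apply: scalev_ge0 => //; exact: ltW.
    by rewrite !scalerDr; exact: op_decompD.
have Qub n m x : (n <= m)%N -> 0 <<= x -> D m x <<= Q n x.
  by move=> nm x0; have [_ /(_ x x0)[ub _]] := QP n; apply: ub; exact: op_decomp1.
have Qge0 n x : 0 <<= x -> 0 <<= Q n x.
  by move=> x0; apply: lev_trans (Qub n n x (leqnn n) x0); have [] := D01 n x x0.
exists Q; split=> //.
- by move=> n; apply: positive_order_bounded => [|z]; [case: (QP n) | exact: Qge0].
- move=> n x x0; have [_ /(_ x x0)[_ least]] := QP n.+1; apply: least => z hz.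
  have [_ /(_ x x0)[ub _]] := QP n; apply: ub.
  elim: hz => [M y nM y0|y1 y2 z1 z2 _ h1 _ h2]; last exact: op_decompD.
  by apply: op_decomp1 => //; exact: ltnW.
- move=> T _ TQ x x0; apply: (Binf x) => // j n; apply: (@lev_trans (Q n x)); first exact: TQ.
  have [_ /(_ x x0)[_ least]] := QP n; apply: least => z.
  by apply: (op_decomp_le (BD j n)) => M y; exact: DB.
- move=> n; split=> x x0; last exact: Qub.
  apply: (@lev_trans 0); last by have [] := D01 n x x0.
  by rewrite lev_oppl oppr0; exact: Qge0.
Qed.

(** * Cesaro means, and the converse direction *)

Lemma sum_decreasing_le q m n : decreasing_to0 q ->
  \sum_(k < n) q k <<= m%:R *: q 0%N + n%:R *: q m.
Proof.
move=> hq; have q0 k : 0 <<= q k by exact: decreasing_to0_ge0.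
have small k : (k <= m)%N -> \sum_(i < k) q i <<= m%:R *: q 0%N + k%:R *: q m.
  move=> km; apply: (@lev_trans (k%:R *: q 0%N)).
    rewrite -[X in X%:R *: _]card_ord scaler_nat -sumr_const.
    by apply: lev_sum => i; exact: decreasing_to0_le.
  apply: (@lev_trans (m%:R *: q 0%N)); first by apply: levZr => //; rewrite ler_nat.
  by apply: lev_addl; apply: scalev_ge0.
have [/small//|/ltnW/subnKC <-] := leqP n m.
elim: (n - m)%N => [|j IH]; first by rewrite addn0; exact: small.
rewrite addnS big_ord_recr /= mulrSr scalerDl scale1r addrA.
by apply: levD => //; apply: decreasing_to0_le => //; exact: leq_addr.
Qed.

Lemma cesaro_decreasing q : decreasing_to0 q ->
  exists2 r, decreasing_to0 r & forall n, n%:R^-1 *: \sum_(k < n) q k <<= r n.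
Proof.
move=> hq; have q0 k : 0 <<= q k by exact: decreasing_to0_ge0.
(* The first [m] terms are bounded by [q 0] and the later ones by [q m]; the factor 2 pays for
   dividing by [n + 1] in place of [n]. *)
pose y m n := n.+1%:R^-1 *: ((2 * m)%:R *: q 0%N) + q m.
have hy m : decreasing_to0 (fun n => n.+1%:R^-1 *: ((2 * m)%:R *: q 0%N)).
  by apply: decreasing_to0_harmonic; apply: scalev_ge0.
have [m n|m n|z zy|r [rglb hr]] := @decreasing_to0_inf_family nat y (inhabits 0%N).
- by apply: addv_ge0 => //; exact: (decreasing_to0_ge0 n (hy m)).
- by apply: levD; [case: (hy m) | exact: lev_refl].
- apply: (decreasing_to0_inf hq) => m; rewrite -[q m]add0r -levBr.
  by apply: (decreasing_to0_inf (hy m)) => n; rewrite levBr; exact: (zy m n).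
exists r => // n; have [_ gt] := rglb n; apply: gt => _ [m ->].
case: n => [|n].
  rewrite invr0 scale0r; apply: addv_ge0 => //.
  exact: (decreasing_to0_ge0 0 (hy m)).
rewrite levZ_invl ?ltr0n //; apply: lev_trans (sum_decreasing_le m n.+1 hq) _.
rewrite scalerDr !scalerA; apply: levD; last exact: lev_refl.
apply: levZr => //; rewrite natrM mulrA ler_peMl //.
rewrite mulrAC ler_pdivlMr ?ltr0n // mul1r -natrM ler_nat.
by rewrite muln2 -addnn addSn ltnS leq_addl.
Qed.

Lemma cesaro_of_density_zero (f : nat -> E) (b : E) P :
  (forall n, 0 <<= f n) -> (forall n, f n <<= b) ->
  (forall n, band_projection le (P n)) -> density_zero le P ->
  oconv le (fun n => f n - P n (f n)) 0 ->
  oconv le (fun n => n%:R^-1 *: \sum_(k < n) f k) 0.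
Proof.
move=> f0 fb hP dP /oconv0_dominated[q hq fq].
have b0 : 0 <<= b := lev_trans (f0 0%N) (fb 0%N).
have [p hp Pp] := oconv_op0_apply dP b0.
have [r hr qr] := cesaro_decreasing hq.
have avg0 n : 0 <= (n%:R : R)^-1 by rewrite invr_ge0.
apply: (oconv0_intro (decreasing_to0D hp hr)) => n.
  by apply: scalev_ge0 => //; exact: sumv_ge0.
apply: lev_trans (levD (Pp n) (qr n)); rewrite -scalerDr -big_split /=.
apply: levZ => //; apply: lev_sum => k; rewrite -{1}[f k : E](subrK (P k (f k))) addrC.
by apply: levD; [exact: fq | exact: band_projection_mono].
Qed.

(** * From small means to a density zero sequence *)

Lemma unit_kernel e P x : weak_order_unit le e -> oproj P -> P e = 0 -> P x = 0.
Proof.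
move=> he hP Pe; have := oproj_full he (oproj_compl hP) _ x.
rewrite /= Pe subr0 => /(_ erefl) /eqP.
by rewrite -subr_eq0 addrAC subrr add0r oppr_eq0 => /eqP.
Qed.

(* The infimum over [t > 0] of [t *: e + t^-1 *: p] plays the role of
   [2 * sqrt (p * e)], which has no direct meaning in a Riesz space. *)
Lemma sqrt_sequence e p : 0 <<= e -> decreasing_to0 p ->
  exists c, (forall n, is_glb le
      (fun z => exists t : {t : R | 0 < t}, z = val t *: e + (val t)^-1 *: p n) (c n)) /\
    decreasing_to0 c.
Proof.
move=> e0 hp; apply: (@decreasing_to0_inf_family {t : R | 0 < t}
  (fun t n => val t *: e + (val t)^-1 *: p n)).
- by split; exists 1.
- move=> [t t0] n /=; apply: addv_ge0; apply: scalev_ge0 => //; rewrite ?invr_ge0 ?ltW //.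
  exact: decreasing_to0_ge0.
- move=> [t t0] n /=; apply: levD; first exact: lev_refl.
  by apply: levZ; [rewrite invr_ge0 ltW | case: hp].
- move=> z zt; apply: (@archimedean z e) => t t0.
  rewrite -[_ *: e]add0r -levBr; apply: (levZK t0); rewrite scaler0.
  apply: (decreasing_to0_inf hp) => n; rewrite -levZ_inv // levBr addrC.
  exact: (zt (exist _ t t0) n).
Qed.

(** From index [n] on the means are dominated by [G (t, n) + t], where [G (t, n)] projects onto the
    band on which [p n] exceeds [t ^+ 2 *: e]. The joint infimum over [t] and [n] is 0, as
    [oconv_op0_intro] requires. *)
Lemma density_zero_threshold e (p c : nat -> E) (P : nat -> E -> E) : weak_order_unit le e ->
  decreasing_to0 p -> (forall n, n.+1%:R^-1 *: e <<= p n) ->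
  (forall n, is_glb le
      (fun z => exists t : {t : R | 0 < t}, z = val t *: e + (val t)^-1 *: p n) (c n)) ->
  decreasing_to0 c -> (forall n, oproj (P n)) ->
  (forall n, \sum_(k < n) P k (c k) <<= n%:R *: p n) ->
  density_zero le P.
Proof.
move=> he hp ep cglb hc hP Pc; have [e0 _] := he.
have p0 n : 0 <<= p n by exact: decreasing_to0_ge0.
have c0 n : 0 <<= c n by exact: decreasing_to0_ge0.
pose v (t : R) n := p n - (t ^+ 2) *: e.
have /choice [G hG] (tn : R * nat) : exists G, principal_proj (pos (v tn.1 tn.2)) G.
  by apply: principal_proj_exists; exact: pos_ge0.
have oG tn : oproj (G tn) by have [] := hG tn.
have Gpos t n : G (t, n) (v t n) = pos (v t n) by exact: principal_proj_pos (hG (t, n)).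
have Gdecr t m n x : (m <= n)%N -> 0 <<= x -> G (t, n) x <<= G (t, m) x.
  move=> mn x0; apply: (le_principal_proj _ (hG (t, n)) (hG (t, m)) x0).
  by apply: le_pos; apply: levD; [exact: decreasing_to0_le | exact: lev_refl].
have ec n : n.+1%:R^-1 *: e <<= c n.
  have [_ gt] := cglb n; apply: gt => _ [[t t0] ->] /=.
  have [t1|t1] := leP 1 t.
    apply: (@lev_trans (t *: e)); last first.
      by apply: lev_addl; apply: scalev_ge0 => //; rewrite invr_ge0 ltW.
    apply: levZr => //; apply: le_trans t1; rewrite invf_le1 ?ltr0n //.
    by rewrite ler1n.
  apply: (@lev_trans (t^-1 *: p n)); last by apply: lev_addr; apply: scalev_ge0 => //; exact: ltW.
  apply: lev_trans (ep n) _; rewrite -{1}[p n]scale1r; apply: levZr => //.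
  by rewrite invf_ge1 // ltW.
(* [c n] dominates a positive multiple of [e], so it is a weak unit: a projection killing it is
   0. *)
have kernel Q n x : oproj Q -> Q (c n) = 0 -> Q x = 0.
  move=> hQ Qc; have [lQ _ _] := hQ; apply: (unit_kernel x he hQ).
  apply: lev_anti; last exact: oproj_ge0.
  have := oproj_mono hQ (ec n); rewrite Qc (linopZ _ _ lQ) levZ_invl ?ltr0n //.
  by rewrite scaler0.
have Sp t n : 0 < t -> p n - G (t, n) (p n) <<= t *: (c n - G (t, n) (c n)).
  move=> t0; have hS := oproj_compl (oG (t, n)).
  set S := fun x => x - G (t, n) x in hS; rewrite -/(S (p n)) -/(S (c n)).
  have [lS SS _] := hS.
  have Sv : S (p n) <<= t ^+ 2 *: S e.
    rewrite -(linopZ _ _ lS) -[X in _ <<= X]add0r -levBr -(linopB _ _ lS).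
    rewrite /S Gpos levBr add0r; exact: pos_ge.
  rewrite -levZ_invl // -(SS (p n)) -(linopZ _ _ lS); apply: (oproj_mono hS).
  have [_ gt] := cglb n; apply: gt => _ [[s s0] ->] /=.
  (* [t^-1 *: S (p n)] is below every member of the family defining [c n]: by its second term if
     [s <= t], and otherwise by its first, since [S (p n) <<= t ^+ 2 *: S e]. *)
  have [st|ts] := leP s t.
    apply: (@lev_trans (s^-1 *: p n)); last by apply: lev_addr; apply: scalev_ge0 => //; exact: ltW.
    apply: (@lev_trans (t^-1 *: p n)).
      by apply: levZ; [rewrite invr_ge0 ltW | exact: oproj_lex].
    by apply: levZr => //; rewrite lef_pV2.
  apply: (@lev_trans (s *: e)); last first.
    by apply: lev_addl; apply: scalev_ge0 => //; rewrite invr_ge0 ltW.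
  apply: (@lev_trans (t *: e)); last by apply: levZr => //; exact: ltW.
  rewrite levZ_invl // scalerA -expr2; apply: lev_trans Sv _.
  by apply: levZ; [exact: sqr_ge0 | exact: oproj_lex].
have sumS t n x : 0 < t -> 0 <<= x ->
    \sum_(k < n) P k (x - G (t, n) x) <<= (n%:R * t) *: (x - G (t, n) x).
  move=> t0 x0; have hS := oproj_compl (oG (t, n)); have [lS SS _] := hS.
  (* The bound is checked at [S (c n)], with [S] the complement of [G (t, n)]: as [c] decreases, the
     sum there is at most [n S (p n)], hence at most [n t S (c n)]. It then transfers to [S x]. *)
  apply: (@sum_oproj_le n P (c n - G (t, n) (c n))) => //.
  - exact: (oproj_ge0 hS).
  - exact: (oproj_ge0 hS).
  - by move=> Q hQ; exact: (kernel _ n x (oproj_comp hQ hS)).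
  rewrite -scalerA; apply: (@lev_trans (n%:R *: (p n - G (t, n) (p n)))); last first.
    by apply: levZ => //; exact: Sp.
  rewrite -(linopZ _ _ lS).
  have -> : \sum_(k < n) P k (c n - G (t, n) (c n)) =
     (fun x => x - G (t, n) x) (\sum_(k < n) P k (c n)).
    rewrite (linop_sum _ lS); apply: eq_bigr => k _.
    by rewrite (oproj_comm _ (hP k) hS).
  apply: (oproj_mono hS); apply: lev_trans (Pc n); apply: lev_sum => k.
  by apply: (oproj_mono (hP k)); apply: decreasing_to0_le => //; exact: ltnW.
have lsum n : linear_op (fun x => n%:R^-1 *: \sum_(k < n) P k x).
  move=> a x y; rewrite [a *: (_ *: _)]scalerA mulrC -scalerA -scalerDr (scaler_sumr a) -big_split /=.
  congr (_ *: _); apply: eq_bigr => k _; have [lP _ _] := hP k; exact: lP.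
have avg0 n : 0 <= (n%:R : R)^-1 by rewrite invr_ge0.
have avg01 n x : 0 <<= x -> 0 <<= n%:R^-1 *: \sum_(k < n) P k x /\
    n%:R^-1 *: \sum_(k < n) P k x <<= x.
  move=> x0; split; first by apply: scalev_ge0 => //; apply: sumv_ge0 => k; exact: oproj_ge0.
  case: n => [|n]; first by rewrite invr0 scale0r.
  rewrite levZ_invl ?ltr0n // -[X in X%:R *: _]card_ord scaler_nat -sumr_const.
  by apply: lev_sum => k; exact: oproj_lex.
apply: (@oconv_op0_intro {t : R | 0 < t} _ (fun t n x => G (val t, n) x + val t *: x)) => //.
- move=> t n x y; have [lG _ _] := oG (val t, n).
  by rewrite (linopD _ _ lG) scalerDr addrACA.
- move=> [t t0] m n x mn x0 /=; have hS := oproj_compl (oG (t, n)).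
  apply: (@lev_trans (G (t, n) x + t *: x)); last first.
    by apply: levD; [exact: Gdecr | exact: lev_refl].
  rewrite -{1}[x](subrK (G (t, n) x)) addrC (linopD _ _ (lsum n)); apply: levD.
    by apply: (avg01 _ _ _).2; exact: oproj_ge0.
  apply: (@lev_trans (t *: (x - G (t, n) x))); last first.
    by apply: levZ; [exact: ltW | exact: (oproj_lex hS)].
  case: n mn hS => [|n] mn hS.
    by rewrite invr0 scale0r; apply: scalev_ge0; [exact: ltW | exact: (oproj_ge0 hS)].
  by rewrite levZ_invl ?ltr0n // scalerA; exact: sumS.
move=> x z x0 zG; apply: (@archimedean z x) => t t0.
set u := z - t *: x; suff /levBr : u <<= 0 by rewrite add0r.
have uG n : pos u <<= G (t, n) x.
  apply: pos_le; last exact: oproj_ge0.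
  by rewrite levBr; exact: (zG (exist _ t t0) n).
rewrite -(_ : pos u = 0); first exact: pos_ge.
(* [pos u] lies in the bands of all [G (t, n)]. For [y] below [pos u] and [e] this gives
   [t ^+ 2 *: pos y <<= p n] for every [n], hence [y <<= 0]. *)
apply: (unit_disjoint he); first exact: pos_ge0.
move=> y ye yu; apply: lev_trans (pos_ge y) _.
have t20 : 0 < t ^+ 2 by exact: exprn_gt0.
apply: (levZK t20); rewrite scaler0; apply: (decreasing_to0_inf hp) => n.
have [lG GG _] := oG (t, n).
have yG : pos y <<= G (t, n) x by apply: lev_trans (uG n); apply: pos_le => //; exact: pos_ge0.
rewrite -(oproj_fix_le (oG (t, n)) (GG x) (pos_ge0 y) yG).
apply: (@lev_trans (t ^+ 2 *: G (t, n) e)).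
  apply: levZ; first exact: ltW.
  by apply: oproj_mono => //; exact: pos_le.
apply: (@lev_trans (G (t, n) (p n))); last exact: oproj_lex.
rewrite -(linopZ _ _ lG) -subv_ge0 -(linopB _ _ lG) -/(v t n) Gpos; exact: pos_ge0.
Qed.

Lemma density_zero_of_cesaro (e : E) (f : nat -> E) : weak_order_unit le e ->
  (forall n, 0 <<= f n) ->
  oconv le (fun n => n%:R^-1 *: \sum_(k < n) f k) 0 ->
  exists P : nat -> E -> E,
    [/\ (forall n, band_projection le (P n)), density_zero le P &
        oconv le (fun n => f n - P n (f n)) 0].
Proof.
move=> he f0 /oconv0_dominated[p0 hp0 fp0]; have [e0 _] := he.
(* The added multiple of [e] keeps every [c n] a weak unit even where [p0 n] vanishes. *)
pose p n := p0 n + n.+1%:R^-1 *: e.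
have hp : decreasing_to0 p by apply: decreasing_to0D => //; exact: decreasing_to0_harmonic.
have [c [cglb hc]] := sqrt_sequence e0 hp.
have /choice [P hP] n : exists P, principal_proj (pos (f n - c n)) P.
  by apply: principal_proj_exists; exact: pos_ge0.
have oP n : oproj (P n) by have [] := hP n.
have Pf n : P n (f n) - P n (c n) = pos (f n - c n).
  by have [lP _ _] := oP n; rewrite -(linopB _ _ lP); exact: principal_proj_pos.
exists P; split=> [n||]; first exact: oproj_band_projection.
- apply: (density_zero_threshold he hp _ cglb hc oP) => n.
    by apply: lev_addr; exact: decreasing_to0_ge0.
  case: n => [|n]; first by rewrite big_ord0 scale0r; exact: lev_refl.
  rewrite -levZ_invl ?ltr0n //; apply: (@lev_trans (p0 n.+1)); last first.
    by apply: lev_addl; apply: scalev_ge0; rewrite ?invr_ge0.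
  apply: lev_trans (fp0 n.+1); apply: levZ; first by rewrite invr_ge0.
  (* A Markov inequality: on the band of [P k] the vector [f k] exceeds [c k], so
     [P k (c k) <<= P k (f k) <<= f k]. *)
  apply: lev_sum => k; apply: (@lev_trans (P k (f k))); last exact: oproj_lex.
  by rewrite -subv_ge0 Pf; exact: pos_ge0.
- apply: (oconv0_intro hc) => n; first by rewrite subv_ge0; exact: oproj_lex.
  apply: (@lev_trans (c n - P n (c n))); last first.
    by apply: (oproj_lex (oproj_compl (oP n))); exact: decreasing_to0_ge0.
  have := pos_ge (f n - c n); rewrite -Pf !levBr.
  by rewrite [_ + c n]addrC addrA addrAC.
Qed.
End RieszSpace.

Theorem theorem3p2 (R : realType) (E : lmodType R) (le : E -> E -> Prop)
  (hR : riesz_space le) (hD : dedekind_complete le)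
  (e : E) (he : weak_order_unit le e)
  (f : nat -> E) (hpos : forall n, le 0 (f n))
  (hbd : exists a b, forall n, le a (f n) /\ le (f n) b) :
  oconv le (fun n => (n%:R)^-1 *: \sum_(k < n) f k) 0 <->
  exists P : nat -> E -> E,
    [/\ (forall n, band_projection le (P n)),
        density_zero le P &
        oconv le (fun n => f n - P n (f n)) 0].
Proof.
split; first exact: (density_zero_of_cesaro hR hD he hpos).
move=> [P [hP dP fP]]; have [a [b fab]] := hbd.
apply: (cesaro_of_density_zero hR hD (b := b) hpos _ hP dP fP) => n.
by have [] := fab n.
Qed.
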